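(* Algorithm B, described in the context, has an approximation ratio of at most $2$ for (iK-ds) with unit improvement costs, and runs in polynomial time; more specifically, in the time required to solve an LP. (Approximation ratio at most $2$ means that on every instance it returns a feasible solution of (iK-ds) whose profit is at least $\tfrac12$ of the optimal objective value.)
   Context: The problem (iK-ds) with unit improvement costs (single-level improvable knapsack with discrete weight improvements): there are $n$ items; item $i$ has profit $p_i\in\mathbb{R}$, original weight $w_i\in\mathbb{R}$ and improved weight $\hat w_i\le w_i$. There are a knapsack budget $B$ and an improvement budget $k$, and improving any item costs $1$. Put $\overline w_i:=w_i-\hat w_i$. The problem is $$\max\sum_{i=1}^n p_ix_i\quad\text{s.t.}\quad \sum_{i=1}^n w_ix_i-\sum_{i=1}^n\overline w_iy_i\le B,\quad \sum_{i=1}^n y_i\le k,\quad y_i\le x_i,\quad x_i,y_i\in\{0,1\}\ \text{ for all } i\in\{1,\ldots,n\}.$$ Its LP relaxation replaces the integrality conditions by $x_i\le 1$ and $y_i\ge 0$, so that each item $i$ has the three constraints $y_i\le x_i$, $x_i\le 1$, $y_i\ge 0$. For sets $S,T\subseteq\{1,\ldots,n\}$, $(S,T)$ denotes the solution that packs the items of $S$ with original weight and the items of $T$ with improved weight, and $p(S,T)$ denotes its profit. Item types with respect to a basic feasible solution of the LP relaxation, according to which of the item's three constraints are tight: type 1: none is tight; type 2: exactly one is tight, namely $x_i=y_i$; type 3: exactly one is tight, namely $y_i=0$ or $x_i=1$; type 4: exactly two are tight (so $x_i,y_i$ are both integral). All three cannot be tight simultaneously. Let $T_r$ be the set of items of type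 $r$, and let $J_r^{w}$ and $J_r^{\overline w}$ be the sets of unimproved and improved item indices of type $r$, respectively; in particular $J_4^{w}$ consists of the type 4 items with $x_i=1,y_i=0$ and $J_4^{\overline w}$ of those with $x_i=y_i=1$. Algorithm B. Input: an instance of (iK-ds) with unit improvement costs. Step 1. Compute an optimal basic solution of the LP relaxation of (iK-ds), and the sets $T_r$, $J_r^{w}$, $J_r^{\overline w}$ for $r=1,2,3,4$. Step 2. If $|T_4|=n$, return the (optimal) solution $(J_4^{w},J_4^{\overline w})$. Step 3. If $|T_4|=n-1$ and $T_1\cup T_2\cup T_3=\{i\}$, return the solution attaining $\max\{p(J_4^{w},J_4^{\overline w}),\,p(\emptyset,\{i\})\}$. Step 4. If $|T_4|=n-2$ and $T_2\cup T_3=\{i,j\}$, labelled without loss of generality so that $\overline w_i\le\overline w_j$, return the solution attaining $\max\{p(J_4^{w},J_4^{\overline w}\cup\{i\}),\,p(\emptyset,\{j\})\}$.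
   Formalization: Step 4 labels i, j by improved weights ŵ_i ≤ ŵ_j (the claim fails with savings w−ŵ); assumed: B ≥ 0, integer k ≥ 1 and 0 ≤ ŵ_i ≤ B, without which the output can be infeasible; polynomial time is relative to a polynomial-time LP solver. *)

(* Defs.v *)
From HB Require Import structures.
From mathcomp Require Import all_boot all_order all_algebra.
Set Implicit Arguments.
Unset Strict Implicit.
Unset Printing Implicit Defensive.
Import Order.TTheory GRing.Theory Num.Theory.
Local Open Scope ring_scope.

(* ------------------------- Linear programming -------------------------- *)

(* max c z  subject to  A z <= b, with free variables z. *)
Record lp (R : realFieldType) := LP {
  lp_rows : nat;
  lp_cols : nat;
  lp_A : 'M[R]_(lp_rows, lp_cols);
  lp_b : 'cV[R]_lp_rows;
  lp_c : 'rV[R]_lp_cols }.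

Definition lp_feasible (R : realFieldType) (L : lp R) (z : 'cV[R]_(lp_cols L)) :=
  forall r, (lp_A L *m z) r 0 <= lp_b L r 0.

Arguments lp_feasible {R} L z.

Definition lp_value (R : realFieldType) (L : lp R) (z : 'cV[R]_(lp_cols L)) : R :=
  (lp_c L *m z) 0 0.

Arguments lp_value {R} L z.

Definition lp_bounded (R : realFieldType) (L : lp R) :=
  exists M : R, forall z, lp_feasible L z -> lp_value L z <= M.

(* The rows of the constraints that are tight at z; the others are zeroed. *)
Definition lp_tight (R : realFieldType) (L : lp R) (z : 'cV[R]_(lp_cols L)) :
    'M[R]_(lp_rows L, lp_cols L) :=
  \matrix_(r, j) (lp_A L r j *+ ((lp_A L *m z) r 0 == lp_b L r 0)).

Definition lp_optimal_basic (R : realFieldType) (L : lp R)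
    (z : 'cV[R]_(lp_cols L)) :=
  [/\ lp_feasible L z, \rank (lp_tight z) = lp_cols L
    & forall z', lp_feasible L z' -> lp_value L z' <= lp_value L z].

Arguments lp_optimal_basic {R} L z.

(* An arbitrary LP solver with its running time.  A feasible bounded LP has an
   optimal basic solution exactly when its matrix has full column rank; on the
   other LPs nothing is required from the solver. *)
Record lp_solver (R : realFieldType) := LPSolver {
  lp_solve : forall L : lp R, 'cV[R]_(lp_cols L);
  lp_time : lp R -> nat;
  lp_solveP : forall L : lp R,
    (exists z, lp_feasible L z) -> lp_bounded L ->
    \rank (lp_A L) = lp_cols L -> lp_optimal_basic L (lp_solve L) }.

(* ----------------- (iK-ds) with unit improvement costs ----------------- *)

Record instance (R : realFieldType) (n : nat) := Instance {
  profit : 'I_n -> R;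
  weight : 'I_n -> R;
  iweight : 'I_n -> R;
  capacity : R;
  ibudget : nat }.

Section Knapsack.
Variables (R : realFieldType) (n : nat) (I : instance R n).

Definition savings (i : 'I_n) : R := weight I i - iweight I i.

(* Weights are nonnegative, every item fits by itself once improved, and at
   least one improvement can be bought.  Profits are unrestricted. *)
Definition admissible :=
  [/\ 0 <= capacity I, (0 < ibudget I)%N
    & forall i, [/\ 0 <= iweight I i, iweight I i <= weight I i
                  & iweight I i <= capacity I]].

Definition feasible (x y : 'I_n -> bool) :=
  [/\ \sum_i weight I i * (x i)%:R - \sum_i savings i * (y i)%:R <= capacity I,
      (\sum_i y i <= ibudget I)%N
    & forall i, (y i <= x i)%N].

Definition objective (x : 'I_n -> bool) : R := \sum_i profit I i * (x i)%:R.

(* The solution (S, T): x is the indicator of the union, y that of T. *)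
Definition set_feasible (S T : {set 'I_n}) :=
  feasible (fun i => i \in S :|: T) (fun i => i \in T).

Definition set_profit (S T : {set 'I_n}) : R :=
  objective (fun i => i \in S :|: T).

Definition approximates (rho : R) (S T : {set 'I_n}) :=
  set_feasible S T /\
  forall x y, feasible x y -> rho^-1 * objective x <= set_profit S T.

(* The variables are x_1, ..., x_n, y_1, ..., y_n.  The rows are, in this order,
   the knapsack budget, the improvement budget, y_i - x_i <= 0, x_i <= 1 and
   - y_i <= 0. *)
Definition relaxation : lp R :=
  @LP R (1 + (1 + (n + (n + n)))) (n + n)
    (col_mx (row_mx (\row_i weight I i) (\row_i - savings i))
    (col_mx (row_mx 0 (const_mx 1))
    (col_mx (row_mx (- 1%:M) 1%:M)
    (col_mx (row_mx 1%:M 0)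
            (row_mx 0 (- 1%:M))))))
    (col_mx (const_mx (capacity I))
    (col_mx (const_mx (ibudget I)%:R)
    (col_mx 0 (col_mx (const_mx 1) 0))))
    (row_mx (\row_i profit I i) 0).

Section Types.
Variable z : 'cV[R]_(n + n).

Definition xval (i : 'I_n) : R := z (lshift n i) 0.
Definition yval (i : 'I_n) : R := z (rshift n i) 0.

Definition ntight (i : 'I_n) : nat :=
  ((xval i == yval i) + (xval i == 1%R) + (yval i == 0%R))%N.

Definition T1 := [set i | ntight i == 0%N].
Definition T2 := [set i | (ntight i == 1%N) && (xval i == yval i)].
Definition T3 := [set i | (ntight i == 1%N) && ((yval i == 0) || (xval i == 1))].
Definition T4 := [set i | ntight i == 2].

Definition J4w := [set i in T4 | (xval i == 1) && (yval i == 0)].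
Definition J4i := [set i in T4 | (xval i == 1) && (yval i == 1)].

Notation sol := ({set 'I_n} * {set 'I_n})%type.

Definition best_of (s1 s2 s : sol) :=
  (s = s1 /\ set_profit s2.1 s2.2 <= set_profit s1.1 s1.2) \/
  (s = s2 /\ set_profit s1.1 s1.2 <= set_profit s2.1 s2.2).

(* [algorithmB s]: s is a possible output when Step 1 has computed z.  It is a
   relation because ties may be broken arbitrarily.  In Step 4 the two items
   are labelled by improved weight: this is the order for which the first
   candidate fits in the knapsack; ordering by savings does not ensure it. *)
Inductive algorithmB : sol -> Prop :=
| Step2 of #|T4| = n : algorithmB (J4w, J4i)
| Step3 i s of #|T4|.+1 = n & T1 :|: T2 :|: T3 = [set i]
    & best_of (J4w, J4i) (set0, [set i]) s : algorithmB s
| Step4 i j s of #|T4|.+2 = n & i != j & T2 :|: T3 = [set i; j]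
    & iweight I i <= iweight I j
    & best_of (J4w, i |: J4i) (set0, [set j]) s : algorithmB s.

End Types.
End Knapsack.

(* ------------------------- Model of computation ------------------------ *)

(* A real RAM with integer registers, two-dimensional arrays of reals and an
   instruction that calls the LP solver.  Numbers can only be added, subtracted
   and compared, so that the unit cost of these operations cannot be exploited
   to build numbers of superpolynomial length. *)

Inductive nexp :=
| NLit of nat
| NReg of nat
| NAdd of nexp & nexp.

Inductive rexp :=
| RZero
| ROne
| RCell of nat & nexp & nexp
| RAdd of rexp & rexp
| RSub of rexp & rexp.

Inductive bexp :=
| BNLe of nexp & nexp
| BRLe of rexp & rexp
| BNot of bexp
| BAnd of bexp & bexp.

(* [CSolve m k a b c z] solves the LP with m rows and k columns whose matrix is
   array a, right-hand side column 0 of b and objective row 0 of c; the solution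
   is written to column 0 of array z. *)
Inductive cmd :=
| CSkip
| CSeq of cmd & cmd
| CNSet of nat & nexp
| CRSet of nat & nexp & nexp & rexp
| CIf of bexp & cmd & cmd
| CWhile of bexp & cmd
| CSolve of nexp & nexp & nat & nat & nat & nat.

Section Semantics.
Variable R : realFieldType.

Record state := State {
  regs : nat -> nat;
  cells : nat -> nat -> nat -> R }.

Fixpoint neval (s : state) (e : nexp) : nat :=
  match e with
  | NLit k => k
  | NReg v => regs s v
  | NAdd e1 e2 => neval s e1 + neval s e2
  end%N.

Fixpoint reval (s : state) (e : rexp) : R :=
  match e with
  | RZero => 0
  | ROne => 1
  | RCell a i j => cells s a (neval s i) (neval s j)
  | RAdd e1 e2 => reval s e1 + reval s e2
  | RSub e1 e2 => reval s e1 - reval s e2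
  end.

Fixpoint beval (s : state) (e : bexp) : bool :=
  match e with
  | BNLe e1 e2 => (neval s e1 <= neval s e2)%N
  | BRLe e1 e2 => reval s e1 <= reval s e2
  | BNot e1 => ~~ beval s e1
  | BAnd e1 e2 => beval s e1 && beval s e2
  end.

Fixpoint ncost (e : nexp) : nat :=
  if e is NAdd e1 e2 then (ncost e1 + ncost e2).+1 else 1%N.

Fixpoint rcost (e : rexp) : nat :=
  match e with
  | RZero | ROne => 1
  | RCell _ i j => (ncost i + ncost j).+1
  | RAdd e1 e2 | RSub e1 e2 => (rcost e1 + rcost e2).+1
  end%N.

Fixpoint bcost (e : bexp) : nat :=
  match e with
  | BNLe e1 e2 => (ncost e1 + ncost e2).+1
  | BRLe e1 e2 => (rcost e1 + rcost e2).+1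
  | BNot e1 => (bcost e1).+1
  | BAnd e1 e2 => (bcost e1 + bcost e2).+1
  end%N.

Definition set_reg (s : state) (v k : nat) : state :=
  State (fun u => if u == v then k else regs s u) (cells s).

Definition set_cell (s : state) (a i j : nat) (r : R) : state :=
  State (regs s) (fun a' i' j' =>
    if [&& a' == a, i' == i & j' == j] then r else cells s a' i' j').

Definition read_lp (s : state) (m k a b c : nat) : lp R :=
  @LP R m k (\matrix_(i, j) cells s a i j) (\col_i cells s b i 0)
    (\row_j cells s c 0 j).

Definition write_col (s : state) (a k : nat) (z : 'cV[R]_k) : state :=
  State (regs s) (fun a' i' j' =>
    if (a' == a) && (j' == 0%N) then
      if insub i' is Some i then z i 0 else cells s a' i' j'
    else cells s a' i' j').

(* [exec O c s s' t]: started in s, c halts in s' after t steps. *)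
Inductive exec (O : lp_solver R) : cmd -> state -> state -> nat -> Prop :=
| ExSkip s : exec O CSkip s s 1
| ExSeq c1 c2 s1 s2 s3 t1 t2 : exec O c1 s1 s2 t1 -> exec O c2 s2 s3 t2 ->
    exec O (CSeq c1 c2) s1 s3 (t1 + t2)
| ExNSet v e s :
    exec O (CNSet v e) s (set_reg s v (neval s e)) (ncost e).+1
| ExRSet a i j e s :
    exec O (CRSet a i j e) s
      (set_cell s a (neval s i) (neval s j) (reval s e))
      (ncost i + ncost j + rcost e).+1
| ExIfT b c1 c2 s s' t : beval s b -> exec O c1 s s' t ->
    exec O (CIf b c1 c2) s s' (bcost b + t).+1
| ExIfF b c1 c2 s s' t : ~~ beval s b -> exec O c2 s s' t ->
    exec O (CIf b c1 c2) s s' (bcost b + t).+1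
| ExWhileF b c s : ~~ beval s b -> exec O (CWhile b c) s s (bcost b).+1
| ExWhileT b c s1 s2 s3 t1 t2 : beval s1 b -> exec O c s1 s2 t1 ->
    exec O (CWhile b c) s2 s3 t2 ->
    exec O (CWhile b c) s1 s3 (bcost b + t1 + t2).+1
| ExSolve m k a b c z s :
    let L := read_lp s (neval s m) (neval s k) a b c in
    exec O (CSolve m k a b c z) s (write_col s z (lp_solve O L))
      (ncost m + ncost k + lp_time O L).+1.

(* Input: register 0 holds n; column 0 of the arrays 0, 1, 2 holds the profits,
   the weights and the improved weights; column 0 of array 3 holds the two
   budgets.  All other registers and cells are 0. *)
Definition load_vec (n : nat) (f : 'I_n -> R) (i : nat) : R :=
  if insub i is Some i' then f i' else 0.

Definition load (n : nat) (I : instance R n) : state :=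
  State (fun v => if v == 0%N then n else 0%N)
    (fun a i j => match a, j with
      | 0%N, 0%N => load_vec (profit I) i
      | 1%N, 0%N => load_vec (weight I) i
      | 2%N, 0%N => load_vec (iweight I) i
      | 3%N, 0%N => match i with
                    | 0%N => capacity I
                    | 1%N => (ibudget I)%:R
                    | _ => 0
                    end
      | _, _ => 0
      end).

(* Output: the indicators of S and T in column 0 of the arrays 4 and 5. *)
Definition output (n : nat) (s : state) : {set 'I_n} * {set 'I_n} :=
  ([set i : 'I_n | cells s 4 i 0 == 1], [set i : 'I_n | cells s 5 i 0 == 1]).

Definition implements_algorithmB (P : cmd) :=
  forall (O : lp_solver R) (n : nat) (I : instance R n), admissible I ->
  exists s t, exec O P (load I) s t /\
    algorithmB I (lp_solve O (relaxation I)) (output n s).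

(* The time of one call to the solver on the LP relaxation, plus O(n). *)
Definition runs_in_lp_time (P : cmd) :=
  exists C : nat, forall (O : lp_solver R) (n : nat) (I : instance R n) s t,
  admissible I -> exec O P (load I) s t ->
  (t <= lp_time O (relaxation I) + C * n.+1)%N.

(* f <= q (g) for some polynomial q. *)
Definition poly_bounded (A : Type) (f g : A -> nat) :=
  exists C d : nat, forall a, (f a <= C * (g a).+1 ^ d)%N.

(* Polynomial time, given that LPs are solved in polynomial time.  The encoding
   lengths [lsize] of LPs and [isize] of instances are arbitrary, so that both
   the dimension and the bit length are covered. *)
Definition runs_in_poly_time (P : cmd) :=
  forall (O : lp_solver R) (lsize : lp R -> nat)
         (isize : {n : nat & instance R n} -> nat),
  poly_bounded (lp_time O) lsize ->
  poly_bounded (fun J => lsize (relaxation (projT2 J))) isize ->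
  (forall J, (projT1 J <= isize J)%N) ->
  exists C d : nat, forall (n : nat) (I : instance R n) s t,
  admissible I -> exec O P (load I) s t ->
  (t <= C * (isize (existT _ n I)).+1 ^ d)%N.

End Semantics.

(* Main.v *)
Require Import Defs.
From mathcomp Require Import all_boot all_order all_algebra.
From mathcomp Require Import ring lra zify.
Set Implicit Arguments.
Unset Strict Implicit.
Unset Printing Implicit Defensive.
Import Order.TTheory GRing.Theory Num.Theory.
Local Open Scope ring_scope.

(** Approximation.  A basic solution has at least 2n tight constraints.  Only
    two of them can be budgets, and an item has at most two tight constraints,
    so the numbers of constraints missing to the individual items add up to at
    most 2 ([tight_deficit]).  Hence at most two items are not of type 4, and
    one of the steps of Algorithm B applies.  A nonintegral item has a
    nonnegative profit, since dropping it keeps the solution feasible.  The LP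
    value is therefore at most the profit of the integral part plus the
    profits of the nonintegral items; this sum is split between the two
    candidates compared by the algorithm, and the better of them has at least
    half of it.

    Feasibility is only delicate when two items i and j are nonintegral.  Both
    budgets are then tight, and y_i + y_j is an integer less than 2.  It is not
    0: otherwise both items would be unimproved, and a shift between x_i and
    x_j that keeps the knapsack row constant would move along all tight
    constraints.  So y_i + y_j = 1 ([budget_shared]).  The two items together
    use at least the convex combination y_i, y_j of their improved weights,
    that is, at least the smaller improved weight: that item fits when it is
    packed improved, and takes over the shared unit of improvement.

    Running time.  The LP has quadratically many coefficients, but only linearly
    many nonzero ones, and untouched memory reads as 0.  One pass over the items
    writes the LP, a second one sums up the packed profit and records the
    nonintegral items, and a third one writes the output.  Each pass is a
    counting loop around straight-line code, whose effect is given by a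
    function on states and whose cost is bounded statically; an invariant per
    loop gives total correctness with a time bound ([halts_for]).  Execution is
    deterministic, so this bound holds for every execution. *)

(** * Rank and tight constraints *)

Lemma rank_le_support (F : fieldType) m n (M : 'M[F]_(m, n)) (S : {set 'I_m}) :
  (forall i, i \notin S -> row i M = 0) -> (\rank M <= #|S|)%N.
Proof.
move=> M0; pose N := rowsub (fun i : 'I_#|S| => enum_val i) M.
apply: leq_trans (rank_leq_row N); apply/mxrankS/row_subP => i.
have [iS|/M0->] := boolP (i \in S); last exact: sub0mx.
have -> : row i M = row (enum_rank_in iS i) N.
  by apply/rowP => j; rewrite !mxE enum_rankK_in.
exact: row_sub.
Qed.

Lemma full_rank_kernel (F : fieldType) m n (M : 'M[F]_(m, n)) :
  \rank M = n <-> (forall v : 'cV_n, M *m v = 0 -> v = 0).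
Proof.
rewrite -mxrank_tr; split=> [rkM v Mv|kerM].
  have/row_free_inj inj : row_free M^T by rewrite /row_free rkM.
  by apply: trmx_inj; apply: inj; rewrite trmx0 mul0mx -trmx_mul Mv trmx0.
apply/eqP; apply: inj_row_free => v vM; apply: trmx_inj; rewrite trmx0.
by apply: kerM; apply: trmx_inj; rewrite trmx_mul trmxK vM trmx0.
Qed.

Lemma forall_split m k (P : 'I_(m + k) -> Prop) :
  (forall i, P (lshift k i)) -> (forall j, P (rshift m j)) -> forall r, P r.
Proof. by move=> Pl Pr r; case: (split_ordP r) => ? ->. Qed.

(** The rows that are not tight are zero in [lp_tight], so that only the tight
    ones have to be checked. *)
Lemma lp_tight_mul (R : realFieldType) (L : lp R) (z v : 'cV[R]_(lp_cols L)) :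
  (forall r, (lp_A L *m z) r 0 = lp_b L r 0 -> (lp_A L *m v) r 0 = 0) ->
  lp_tight z *m v = 0.
Proof.
move=> tv; apply/colP => r; rewrite !mxE.
under eq_bigr do rewrite mxE mulrnAl.
rewrite sumrMnl; case: eqP => [/tv|_]; last by rewrite mulr0n.
by rewrite mxE mulr1n.
Qed.

(** * The LP relaxation in terms of items *)

Section Relaxation.
Variables (R : realFieldType) (n : nat) (I : instance R n).
Implicit Types (x y : 'I_n -> R) (z : 'cV[R]_(n + n)).

Definition point x y : 'cV[R]_(n + n) := col_mx (\col_i x i) (\col_i y i).

Lemma xval_point x y i : xval (point x y) i = x i.
Proof. by rewrite /xval col_mxEu mxE. Qed.

Lemma yval_point x y i : yval (point x y) i = y i.
Proof. by rewrite /yval col_mxEd mxE. Qed.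

Lemma point_val z : point (xval z) (yval z) = z.
Proof.
by rewrite -[RHS]vsubmxK; congr col_mx; apply/colP => i; rewrite !mxE.
Qed.

Definition used_capacity x y := \sum_i (weight I i * x i - savings I i * y i).

Lemma relaxation_mul z : lp_A (relaxation I) *m z =
  col_mx (const_mx (used_capacity (xval z) (yval z)))
 (col_mx (const_mx (\sum_i yval z i))
 (col_mx (\col_i (yval z i - xval z i))
 (col_mx (\col_i xval z i) (\col_i - yval z i)))).
Proof.
rewrite -{1}(point_val z) /= !mul_col_mx !mul_row_col !mul0mx !addr0 !add0r.
rewrite !mulNmx !mul1mx.
congr col_mx; [|congr col_mx; [|congr col_mx; [|congr col_mx]]].
- apply/colP => i; rewrite !mxE /used_capacity sumrB -sumrN.
  by congr (_ + _); apply: eq_bigr => j _; rewrite !mxE ?mulNr.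
- apply/colP => i; rewrite !mxE.
  by apply: eq_bigr => j _; rewrite !mxE mul1r.
- by apply/colP => i; rewrite !mxE addrC.
- by apply/colP => i; rewrite !mxE.
Qed.

Lemma relaxation_value z :
  lp_value (relaxation I) z = \sum_i profit I i * xval z i.
Proof.
rewrite /lp_value -{1}(point_val z) /= mul_row_col mul0mx addr0 mxE.
by apply: eq_bigr => j _; rewrite !mxE.
Qed.

Definition relaxed_feasible x y :=
  [/\ used_capacity x y <= capacity I, \sum_i y i <= (ibudget I)%:R
    & forall i, [/\ y i <= x i, x i <= 1 & 0 <= y i]].

Lemma relaxation_feasible z :
  lp_feasible (relaxation I) z <-> relaxed_feasible (xval z) (yval z).
Proof.
rewrite /lp_feasible relaxation_mul; split=> [fz|[fB fk fi]].
  have fB := fz (lshift _ 0); have fk := fz (rshift 1 (lshift _ 0)).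
  have fyx i := fz (rshift 1 (rshift 1 (lshift _ i))).
  have fx i := fz (rshift 1 (rshift 1 (rshift n (lshift _ i)))).
  have fy i := fz (rshift 1 (rshift 1 (rshift n (rshift n i)))).
  split=> [||i].
  - by rewrite !(col_mxEu, mxE) in fB.
  - by rewrite !(col_mxEu, col_mxEd, mxE) in fk.
  - move: (fyx i) (fx i) (fy i); rewrite /= !(col_mxEu, col_mxEd) !mxE.
    by rewrite subr_le0 oppr_le0.
do 4?apply: forall_split => [i|];
  try (by rewrite /= !(col_mxEu, col_mxEd) !mxE //; have [? ? ?] := fi i;
          rewrite ?subr_le0 ?oppr_le0).
by move=> i; rewrite /= !(col_mxEu, col_mxEd) !mxE //; have [? ? ?] := fi i;
          rewrite ?subr_le0 ?oppr_le0.
Qed.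

Lemma feasible_relaxed (x y : 'I_n -> bool) :
  feasible I x y <-> relaxed_feasible (fun i => (x i)%:R) (fun i => (y i)%:R).
Proof.
rewrite /feasible /relaxed_feasible /used_capacity sumrB -natr_sum ler_nat.
split=> -[-> -> xy]; split=> // i; last by have [] := xy i; rewrite ler_nat.
by rewrite ler_nat xy lern1 leq_b1 ler0n.
Qed.

End Relaxation.

(** * Item types of a basic solution *)

Section ItemTypes.
Variables (R : realFieldType) (n : nat) (I : instance R n).
Implicit Types (z : 'cV[R]_(n + n)) (i j : 'I_n).

(** Three tight constraints would give 0 = y = x = 1. *)
Lemma ntight_le2 z i : (ntight z i <= 2)%N.
Proof.
rewrite /ntight; case: (eqVneq (xval z i) 1) => [->|_]; last by do 2!case: eqP.
by case: (eqVneq (yval z i) 0) => [->|_]; [rewrite oner_eq0 | case: eqP].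
Qed.

Lemma mem_T4 z i : (i \in T4 z) =
  [|| (xval z i == 1) && (yval z i == 0), (xval z i == 1) && (yval z i == 1)
    | (xval z i == 0) && (yval z i == 0)].
Proof.
rewrite inE /ntight.
have [-> | x1] := eqVneq (xval z i) 1.
  rewrite oner_eq0 [1 == _]eq_sym.
  have [-> | _] := eqVneq (yval z i) 0; last by case: (_ == 1).
  by rewrite [0 == 1]eq_sym oner_eq0.
by have [-> | _] := eqVneq (yval z i) 0; rewrite /= ?andbF ?andbT;
  case: (xval z i == _).
Qed.

Lemma T123E z : T1 z :|: T2 z :|: T3 z = ~: T4 z.
Proof.
apply/setP => i; rewrite !inE; move: (ntight_le2 z i); rewrite /ntight.
by case: (xval z i == yval z i); case: (xval z i == 1); case: (yval z i == 0).
Qed.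

Lemma mem_T23 z i : (i \in T2 z :|: T3 z) = (ntight z i == 1%N).
Proof.
rewrite !inE /ntight.
by case: (xval z i == yval z i); case: (xval z i == 1); case: (yval z i == 0).
Qed.

Lemma T23_sub z : T2 z :|: T3 z \subset ~: T4 z.
Proof. by apply/subsetP => i; rewrite mem_T23 !inE => /eqP ->. Qed.

(** The rank is at most the number of nonzero rows, counted by block: the two
    budgets, and then three rows per item. *)
Lemma rank_tight z : (\rank (lp_tight (z : 'cV_(lp_cols (relaxation I)))) <=
  (used_capacity I (xval z) (yval z) == capacity I)%R +
  (\sum_i yval z i == (ibudget I)%:R)%R + \sum_i ntight z i)%N.
Proof.
pose L := relaxation I.
pose S := [set r | (lp_A L *m z) r 0 == lp_b L r 0].
apply: (@leq_trans #|S|).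
  apply: rank_le_support => r; rewrite inE => /negPf nt.
  by apply/rowP => j; rewrite [LHS]mxE [LHS]mxE -/L nt [RHS]mxE.
rewrite -sum1_card big_mkcond /=.
rewrite (eq_bigr (fun r => ((lp_A L *m z) r 0 == lp_b L r 0) : nat)); last first.
  by move=> r _; rewrite inE; case: eqP.
rewrite relaxation_mul /= 4!big_split_ord !big_ord1 /= -addnA leq_add //.
  by rewrite !col_mxEu !mxE.
rewrite leq_add //; first by rewrite !(col_mxEd, col_mxEu) !mxE.
rewrite -!big_split /=; apply: leq_sum => i _.
rewrite !(col_mxEd, col_mxEu) !mxE subr_eq0 oppr_eq0 /ntight addnA.
by rewrite [yval z i == xval _ _]eq_sym.
Qed.

Lemma tight_deficit z : lp_optimal_basic (relaxation I) z ->
  (\sum_i (2 - ntight z i) <=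
   (used_capacity I (xval z) (yval z) == capacity I)%R +
   (\sum_i yval z i == (ibudget I)%:R)%R)%N.
Proof.
case=> _ rkz _; have := rank_tight z; rewrite rkz /=.
have -> : (n + n = \sum_i (2 - ntight z i) + \sum_i ntight z i)%N.
  rewrite -big_split /= (eq_bigr (fun=> 2%N)).
    by rewrite sum_nat_const card_ord muln2 addnn.
  by move=> i _; rewrite subnK // ntight_le2.
by rewrite leq_add2r.
Qed.

Lemma card_nonintegral z : lp_optimal_basic (relaxation I) z ->
  (#|~: T4 z| <= 2)%N.
Proof.
move=> /tight_deficit le2; apply: leq_trans (leq_trans le2 _).
  rewrite -sum1_card [X in (X <= _)%N]big_mkcond leq_sum //= => i _.
  rewrite !inE; case: eqP (ntight_le2 z i) => //=.
  by case: (ntight z i) => [|[|[]]].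
by do 2!case: eqP.
Qed.

(** Two nonintegral items exhaust the deficit of 2, so each of them misses a
    single constraint, and both budgets are tight. *)
Lemma two_nonintegral z i j : lp_optimal_basic (relaxation I) z ->
  i != j -> ~: T4 z = [set i; j] ->
  [/\ ntight z i = 1%N, ntight z j = 1%N & \sum_k yval z k = (ibudget I)%:R].
Proof.
move=> /tight_deficit; rewrite (bigD1 i) //= => le2 ij Tij.
move: le2; rewrite (bigD1 j) 1?eq_sym //= addnA => le2.
have {le2} := leq_trans (leq_addr _ _) le2.
have : i \in ~: T4 z by rewrite Tij !inE eqxx.
have : j \in ~: T4 z by rewrite Tij !inE eqxx orbT.
rewrite !inE; move: (ntight_le2 z i) (ntight_le2 z j).
case: (ntight z i) => [|[|[]]] //; case: (ntight z j) => [|[|[]]] // _ _ _ _;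
  by do 2!case: eqP.
Qed.

Lemma nonintegral_cases z : lp_optimal_basic (relaxation I) z ->
  [\/ ~: T4 z = set0, exists i, ~: T4 z = [set i]
    | exists i j, [/\ i != j, iweight I i <= iweight I j
                    & ~: T4 z = [set i; j]]].
Proof.
move=> /card_nonintegral; case E: #|~: T4 z| => [|[|[|]]] // _.
- by constructor 1; apply: cards0_eq.
- by constructor 2; apply/cards1P/eqP.
- constructor 3; have /cards2P[i [j [ij ->]]] : #|~: T4 z| == 2 by rewrite E.
  have [le|lt] := leP (iweight I i) (iweight I j); first by exists i, j.
  by exists j, i; rewrite eq_sym ij ltW // setUC.
Qed.

Lemma cardT4 z : #|T4 z| = (n - #|~: T4 z|)%N.
Proof. by have := cardsC (T4 z); rewrite card_ord; lia. Qed.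

Lemma algorithmB_step2 z : ~: T4 z = set0 -> algorithmB I z (J4w z, J4i z).
Proof. by move=> T0; apply: Step2; rewrite cardT4 T0 cards0 subn0. Qed.

Lemma algorithmB_step3 z i s : ~: T4 z = [set i] ->
  best_of I (J4w z, J4i z) (set0, [set i]) s -> algorithmB I z s.
Proof.
move=> Ti; apply: Step3; last by rewrite T123E.
by rewrite cardT4 Ti cards1 subn1 prednK // (leq_ltn_trans _ (ltn_ord i)).
Qed.

Lemma algorithmB_step4 z i j s : lp_optimal_basic (relaxation I) z ->
  i != j -> ~: T4 z = [set i; j] -> iweight I i <= iweight I j ->
  best_of I (J4w z, i |: J4i z) (set0, [set j]) s -> algorithmB I z s.
Proof.
move=> zopt ij Tij; have [ni nj _] := two_nonintegral zopt ij Tij.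
apply: Step4 => //.
  have := subset_leq_card (subsetT [set i; j]).
  rewrite cardT4 Tij cardsT card_ord cards2 ij => le2.
  by rewrite -addn2 subnK.
apply/eqP; rewrite eqEsubset -Tij T23_sub /= Tij; apply/subsetP => k.
by rewrite mem_T23 !inE => /orP[]/eqP->; rewrite ?ni ?nj.
Qed.

Lemma best_ofP (s1 s2 : {set 'I_n} * {set 'I_n}) : exists s, best_of I s1 s2 s.
Proof.
have [le|/ltW le] := leP (set_profit I s2.1 s2.2) (set_profit I s1.1 s1.2).
  by exists s1; left.
by exists s2; right.
Qed.

Lemma algorithmB_total z : lp_optimal_basic (relaxation I) z ->
  exists s, algorithmB I z s.
Proof.
move=> zopt; have [T0|[i Ti]|[i [j [ij wij Tij]]]] := nonintegral_cases zopt.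
- by exists (J4w z, J4i z); apply: algorithmB_step2.
- have [s bs] := best_ofP (J4w z, J4i z) (set0, [set i]).
  by exists s; apply: algorithmB_step3 Ti bs.
- have [s bs] := best_ofP (J4w z, i |: J4i z) (set0, [set j]).
  by exists s; apply: algorithmB_step4 bs.
Qed.

End ItemTypes.

(** * The approximation ratio *)

Section Approximation.
Variables (R : realFieldType) (n : nat) (I : instance R n).
Implicit Types (z : 'cV[R]_(n + n)) (i j k : 'I_n) (f : 'I_n -> R -> R -> R).

(** Capacity, number of improvements and profit are all sums over the items of
    a function [f] of x and y that vanishes at 0; this lemma and the two below
    evaluate such sums at the solutions that occur in the algorithm. *)
Lemma sum_integral_part z f : (forall k, f k 0 0 = 0) ->
  \sum_k f k (xval z k) (yval z k) =
  \sum_k f k (k \in J4w z :|: J4i z)%:R (k \in J4i z)%:R +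
  \sum_(k in ~: T4 z) f k (xval z k) (yval z k).
Proof.
move=> f0; rewrite [X in _ + X]big_mkcond -big_split; apply: eq_bigr => k _.
rewrite !in_setU !(in_set (fun k => (k \in T4 z) && _)) in_setC mem_T4.
case: (eqVneq (xval z k) 1) => [->|x1] /=.
  case: (eqVneq (yval z k) 0) => [->|y0] /=.
    by rewrite [0 == 1]eq_sym oner_eq0 /= addr0.
  case: (eqVneq (yval z k) 1) => [->|y1] /=; rewrite ?addr0 //.
  by rewrite !andbF /= f0 add0r.
rewrite !andbF /= f0 add0r.
by case: eqP => [->|_] //=; case: eqP => [->|_] //=; rewrite f0.
Qed.

Lemma sum_add_item z i f : (forall k, f k 0 0 = 0) -> i \notin T4 z ->
  \sum_k f k (k \in J4w z :|: (i |: J4i z))%:R (k \in i |: J4i z)%:R =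
  \sum_k f k (k \in J4w z :|: J4i z)%:R (k \in J4i z)%:R + f i 1 1.
Proof.
move=> f0 /negPf iT; rewrite (bigD1 i) // [in RHS](bigD1 i) //=.
rewrite !in_setU !(in_set (fun k => (k \in T4 z) && _)) iT set11 /= f0 add0r.
rewrite addrC; congr (_ + _); apply: eq_bigr => k /negPf ki.
by rewrite !in_setU in_set1 ki.
Qed.

Lemma sum_single_item i f : (forall k, f k 0 0 = 0) ->
  \sum_k f k (k \in set0 :|: [set i])%:R (k \in [set i])%:R = f i 1 1.
Proof.
move=> f0; rewrite (bigD1 i) //= big1 ?addr0 => [|k /negPf ki].
  by rewrite !inE eqxx.
by rewrite !inE ki.
Qed.

Lemma set_feasibleE (S T : {set 'I_n}) : set_feasible I S T <->
  used_capacity I (fun k => (k \in S :|: T)%:R) (fun k => (k \in T)%:R)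
    <= capacity I /\
  \sum_k (k \in T)%:R <= (ibudget I)%:R :> R.
Proof.
rewrite /set_feasible feasible_relaxed; split=> [[] // | [fB fk]].
split=> // k; rewrite !ler_nat lern1 leq_b1 ler0n in_setU.
by split=> //; case: (k \in T); rewrite ?orbT.
Qed.

Lemma relaxation_bound z x y : lp_optimal_basic (relaxation I) z ->
  relaxed_feasible I x y ->
  \sum_k profit I k * x k <= \sum_k profit I k * xval z k.
Proof.
case=> _ _ zmax fxy; rewrite -relaxation_value.
have -> : \sum_k profit I k * x k = lp_value (relaxation I) (point x y).
  by rewrite relaxation_value; apply: eq_bigr => k _; rewrite xval_point.
apply: zmax; apply/relaxation_feasible; case: fxy => fB fk fi; split.
- move: fB; congr (_ <= _); apply: eq_bigr => k _.
  by rewrite xval_point yval_point.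
- by move: fk; congr (_ <= _); apply: eq_bigr => k _; rewrite yval_point.
- by move=> k; rewrite xval_point yval_point.
Qed.

(** The used capacity is iweight * x plus savings * (x - y). *)
Lemma iweight_le_use x y i : admissible I -> y <= x ->
  iweight I i * x <= weight I i * x - savings I i * y.
Proof.
case=> _ _ /(_ i)[_ lew _] yx; rewrite /savings -subr_ge0.
have -> : weight I i * x - (weight I i - iweight I i) * y - iweight I i * x =
  (weight I i - iweight I i) * (x - y) by ring.
by rewrite mulr_ge0 // subr_ge0.
Qed.

Lemma use_ge0 x y i : admissible I -> y <= x -> 0 <= x ->
  0 <= weight I i * x - savings I i * y.
Proof.
move=> adm yx x0; apply: le_trans (iweight_le_use i adm yx).
by case: adm => _ _ /(_ i)[w0 _ _]; rewrite mulr_ge0.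
Qed.

(** Dropping an item frees capacity and improvements, so an optimal solution
    does not pack, even partly, an item of negative profit. *)
Lemma nonintegral_profit_ge0 z i : admissible I ->
  lp_optimal_basic (relaxation I) z -> i \notin T4 z -> 0 <= profit I i.
Proof.
move=> adm zopt iT; have [/relaxation_feasible [fB fk fi] _ _] := zopt.
have [yx x1 y0] := fi i.
(* x = 0 would force y = 0, and the item would be of type 4. *)
have x0 : 0 < xval z i.
  rewrite lt_neqAle (le_trans y0 yx) andbT eq_sym; apply: contraNneq iT => x0.
  rewrite mem_T4 x0 eqxx /=; move: yx; rewrite x0 => y0'.
  by rewrite [_ == 0]eq_le y0 y0' !orbT.
pose drop (u : 'I_n -> R) k := if k == i then 0 else u k.
have : relaxed_feasible I (drop (xval z)) (drop (yval z)).
  split=> [||k].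
  - apply: le_trans fB; apply: ler_sum => k _; rewrite /drop; case: eqP => // _.
    have [yx' _ y0'] := fi k.
    by rewrite !mulr0 subr0 use_ge0 // (le_trans y0' yx').
  - apply: le_trans fk; apply: ler_sum => k _; rewrite /drop.
    by case: eqP => // _; have [] := fi k.
  - by rewrite /drop; case: eqP => // _; rewrite ler01.
move=> /(relaxation_bound zopt); rewrite (bigD1 i) // [leRHS](bigD1 i) //=.
rewrite /drop eqxx mulr0 add0r.
rewrite (eq_bigr (fun k => profit I k * xval z k)) => [|k /negPf-> //].
by rewrite lerDr pmulr_lge0.
Qed.

Lemma profitE (S T : {set 'I_n}) : set_profit I S T =
  \sum_k (fun k a (_ : R) => profit I k * a) k (k \in S :|: T)%:R (k \in T)%:R.
Proof. by []. Qed.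

Lemma optimal_profit z : \sum_k profit I k * xval z k =
  set_profit I (J4w z) (J4i z) + \sum_(k in ~: T4 z) profit I k * xval z k.
Proof.
by rewrite (sum_integral_part z (fun k => mulr0 (profit I k))
  (f := fun k a _ => profit I k * a)).
Qed.

Lemma integral_part_feasible z : admissible I ->
  lp_feasible (relaxation I) z -> set_feasible I (J4w z) (J4i z).
Proof.
move=> adm /relaxation_feasible[fB fk fi]; apply/set_feasibleE; split.
  apply: le_trans fB; rewrite /used_capacity.
  rewrite (sum_integral_part z
    (f := fun k a b => weight I k * a - savings I k * b)).
    rewrite lerDl sumr_ge0 // => k _; have [yx _ y0] := fi k.
    by rewrite use_ge0 // (le_trans y0 yx).
  by move=> k; rewrite !mulr0 subr0.
apply: le_trans fk; rewrite (sum_integral_part z (f := fun k _ b => b)) // lerDl.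
by rewrite sumr_ge0 // => k _; have [] := fi k.
Qed.

Lemma single_item_feasible i : admissible I -> set_feasible I set0 [set i].
Proof.
case=> _ k0 /(_ i)[_ _ leB]; apply/set_feasibleE; split.
  rewrite /used_capacity.
  rewrite (sum_single_item i
    (f := fun k a b => weight I k * a - savings I k * b)).
    by rewrite !mulr1 /savings opprB addrC subrK.
  by move=> k; rewrite !mulr0 subr0.
by rewrite (sum_single_item i (f := fun k _ b => b)) // ler1n.
Qed.

Lemma ntight1_bounds z i : relaxed_feasible I (xval z) (yval z) ->
  ntight z i = 1%N -> [/\ 0 <= yval z i, yval z i < 1 & xval z i != 0].
Proof.
case=> _ _ /(_ i)[yx x1 y0] nt.
have : i \notin T4 z by rewrite inE nt.
rewrite mem_T4 !negb_or => /and3P[a b c]; split=> //.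
  rewrite lt_neqAle (le_trans yx x1) andbT; apply: contraNneq b => y1.
  by rewrite y1 eqxx andbT eq_le x1 -y1.
apply: contraNneq c => x0; rewrite x0 eqxx /= eq_le y0 andbT.
by rewrite -x0.
Qed.

Lemma set_profit_add_item z i : i \notin T4 z ->
  set_profit I (J4w z) (i |: J4i z) =
  set_profit I (J4w z) (J4i z) + profit I i.
Proof.
move=> iT.
rewrite profitE (sum_add_item _ iT (f := fun k a _ => profit I k * a)) => [|k].
  by rewrite mulr1.
by rewrite mulr0.
Qed.

(** The improvement budget is tight and the type 4 items use an integral amount
    of it, so that two nonintegral items share an integral amount too.  If they
    shared nothing, the constraints tight at them would not determine x_i and
    x_j. *)
Lemma budget_shared z i j : lp_optimal_basic (relaxation I) z ->
  i != j -> ~: T4 z = [set i; j] -> yval z i + yval z j = 1.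
Proof.
move=> zopt ij Tij; have [ni nj sk] := two_nonintegral zopt ij Tij.
have [/relaxation_feasible fz rkz _] := zopt; have [_ _ fi] := fz.
have [yi0 yi1 xi0] := ntight1_bounds fz ni.
have [yj0 yj1 xj0] := ntight1_bounds fz nj.
have sij (f : 'I_n -> R) : \sum_(k in ~: T4 z) f k = f i + f j.
  by rewrite Tij big_setU1 ?inE //= big_set1.
move: sk; rewrite (sum_integral_part z (f := fun k _ b => b)) // sij.
rewrite -natr_sum; set m := (\sum_k _)%N => smk.
have lem : (m <= ibudget I)%N by rewrite -(ler_nat R) -smk lerDl addr_ge0.
have : yval z i + yval z j = (ibudget I - m)%:R.
  by rewrite natrB // -smk; ring.
have : (ibudget I - m < 2)%N.
  by rewrite -(ltr_nat R) natrB // -smk; lra.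
(* Only a shared amount of 0 is left to exclude. *)
case: (ibudget I - m)%N => [|[|]] // _ y0; exfalso.
have yi : yval z i = 0 by lra.
have yj : yval z j = 0 by lra.
have nti k : ntight z k = 1%N -> yval z k = 0 ->
    xval z k != 0 /\ xval z k != 1.
  by rewrite /ntight => + yk; rewrite yk eqxx; do 2!case: eqP.
have [{}xi0 xi1] := nti i ni yi; have [{}xj0 xj1] := nti j nj yj.
(* A nonzero shift (a, b) of (x_i, x_j) that keeps the used capacity. *)
have [a [b [ab wab]]] : exists a b : R,
    (a != 0) || (b != 0) /\ weight I i * a + weight I j * b = 0.
  have [w0|w0] := eqVneq (weight I i) 0.
    by exists 1, 0; rewrite oner_eq0 w0 mul0r mulr0 addr0.
  exists (weight I j), (- weight I i); rewrite oppr_eq0 w0 orbT.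
  by split=> //; ring.
pose d k := if k == i then a else if k == j then b else 0.
pose v := point d (fun=> 0).
have v0 : v = 0.
  have/full_rank_kernel kerz := rkz; apply: kerz; apply: lp_tight_mul.
  rewrite !relaxation_mul; apply: forall_split => [r _|].
    rewrite !col_mxEu !mxE /used_capacity (bigD1 i) //= (bigD1 j) 1?eq_sym //=.
    rewrite !xval_point !yval_point !mulr0 !subr0 /d !eqxx.
    rewrite [j == i]eq_sym (negPf ij) addrA wab add0r big1 // => k /andP[ki kj].
    by rewrite xval_point yval_point /d (negPf ki) (negPf kj) !mulr0 subr0.
  apply: forall_split => [r _|].
    by rewrite col_mxEd col_mxEu mxE big1 // => k _; rewrite yval_point.
  have dE k : xval v k != 0 -> k = i \/ k = j.
    rewrite xval_point /d; case: (k =P i) => [|_]; first by left.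
    by case: (k =P j) => [|_]; [right|rewrite eqxx].
  apply: forall_split => [k|].
    rewrite !(col_mxEd, col_mxEu) !mxE yval_point sub0r => /eqP.
    rewrite subr_eq0 => xy; apply/eqP; rewrite oppr_eq0; apply: contraTT xy.
    by case/dE=> ->; rewrite ?yi ?yj eq_sym.
  apply: forall_split => [k|k _]; rewrite !(col_mxEd, col_mxEu) !mxE.
    move=> /eqP x1; apply/eqP; apply: contraTT x1.
    by case/dE=> ->.
  by rewrite yval_point oppr0.
have : (d i != 0) || (d j != 0) by rewrite /d !eqxx [j == i]eq_sym (negPf ij).
rewrite -(xval_point d (fun=> 0) i) -(xval_point d (fun=> 0) j) -/v v0.
by rewrite /xval !mxE eqxx.
Qed.

(** As y_i + y_j = 1, the items i and j use at least the capacity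
    iweight i * y_i + iweight j * y_j >= iweight i, and one improvement. *)
Lemma add_item_feasible z i j : admissible I ->
  lp_optimal_basic (relaxation I) z -> i != j -> ~: T4 z = [set i; j] ->
  iweight I i <= iweight I j -> set_feasible I (J4w z) (i |: J4i z).
Proof.
move=> adm zopt ij Tij wij.
have yij := budget_shared zopt ij Tij.
have [/relaxation_feasible [fB fk fi] _ _] := zopt.
have sij (f : 'I_n -> R) : \sum_(k in ~: T4 z) f k = f i + f j.
  by rewrite Tij big_setU1 ?inE //= big_set1.
have iT : i \notin T4 z by rewrite -in_setC Tij !inE eqxx.
apply/set_feasibleE; split.
  apply: le_trans fB; rewrite /used_capacity.
  pose f k a b := weight I k * a - savings I k * b.
  have f0 k : f k 0 0 = 0 by rewrite /f !mulr0 subr0.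
  rewrite (sum_add_item f0 iT) (sum_integral_part z f0) sij lerD2l.
  have [yxi _ yi0] := fi i; have [yxj _ yj0] := fi j.
  have := iweight_le_use i adm yxi; have := iweight_le_use j adm yxj.
  rewrite -/(f i (xval z i) (yval z i)) -/(f j (xval z j) (yval z j)).
  have -> : f i 1 1 = iweight I i by rewrite /f /savings; ring.
  have [_ _ wge0] := adm.
  have [wi0 _ _] := wge0 i; have [wj0 _ _] := wge0 j.
  have : iweight I i * yval z i <= iweight I i * xval z i by rewrite ler_wpM2l.
  have : iweight I j * yval z j <= iweight I j * xval z j by rewrite ler_wpM2l.
  have : iweight I i * yval z j <= iweight I j * yval z j by rewrite ler_wpM2r.
  have : iweight I i * yval z i + iweight I i * yval z j = iweight I i.
    by rewrite -mulrDr yij mulr1.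
  lra.
apply: le_trans fk.
by rewrite (sum_add_item _ iT (f := fun k _ b => b)) //
   (sum_integral_part z (f := fun k _ b => b)) // sij lerD2l yij.
Qed.

Lemma best_of_ge (s1 s2 s : {set 'I_n} * {set 'I_n}) : best_of I s1 s2 s ->
  set_profit I s1.1 s1.2 + set_profit I s2.1 s2.2 <= 2 * set_profit I s.1 s.2.
Proof. by case=> -[->]; lra. Qed.

Lemma best_of_feasible (s1 s2 s : {set 'I_n} * {set 'I_n}) : best_of I s1 s2 s ->
  set_feasible I s1.1 s1.2 -> set_feasible I s2.1 s2.2 ->
  set_feasible I s.1 s.2.
Proof. by case=> -[->]. Qed.

Lemma half_approximates z (S T : {set 'I_n}) :
  lp_optimal_basic (relaxation I) z -> set_feasible I S T ->
  \sum_k profit I k * xval z k <= 2 * set_profit I S T -> approximates I 2 S T.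
Proof.
move=> zopt fST zST; split=> // x y /feasible_relaxed fxy.
rewrite ler_pdivrMl //; apply: le_trans zST.
exact: relaxation_bound zopt fxy.
Qed.

Lemma single_item_profit i : set_profit I set0 [set i] = profit I i.
Proof.
rewrite profitE (sum_single_item i (f := fun k a _ => profit I k * a)) => [|k].
  by rewrite mulr1.
by rewrite mulr0.
Qed.

(** The two candidates have together at least the LP value; in Step 2 there is a
    single one, and the LP value is nonnegative. *)
Lemma algorithmB_approximates z S T : admissible I ->
  lp_optimal_basic (relaxation I) z -> algorithmB I z (S, T) ->
  approximates I 2 S T.
Proof.
move=> adm zopt; move E: (S, T) => s ABs.
rewrite -[S]/((S, T).1) -[T in approximates _ _ _ T]/((S, T).2) {}E.
have [fz _ _] := zopt; have /relaxation_feasible[_ _ fi] := fz.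
have f4 := integral_part_feasible adm fz.
have px k : k \in ~: T4 z -> profit I k * xval z k <= profit I k.
  rewrite in_setC => kT; have [_ x1 _] := fi k.
  by rewrite ler_piMr // (nonintegral_profit_ge0 adm zopt kT).
case: ABs => {s} [cT|i s cT|i j s cT ij].
- have T0 : ~: T4 z = set0.
    by apply/cards0_eq; have := cardsC (T4 z); rewrite card_ord; lia.
  apply: (half_approximates zopt f4); rewrite /=.
  have := optimal_profit z; rewrite T0 big_set0 addr0 => zE.
  have : relaxed_feasible I (fun=> 0) (fun=> 0).
    split=> [||k]; last by rewrite ler01.
      by rewrite /used_capacity big1 => [|k _]; [case: adm|rewrite !mulr0 subr0].
    by rewrite big1.
  move=> /(relaxation_bound zopt); rewrite big1 => [|k _]; last by rewrite mulr0.
  by rewrite zE; lra.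
- rewrite T123E => Ti bs; apply: (half_approximates zopt).
    exact: best_of_feasible bs f4 (single_item_feasible i adm).
  apply: le_trans (best_of_ge bs).
  rewrite optimal_profit Ti big_set1 lerD2l single_item_profit px //.
  by rewrite Ti inE.
- move=> T23 wij bs.
  have Tij : ~: T4 z = [set i; j].
    apply/esym/eqP; rewrite eqEcard -T23 T23_sub T23 cards2 ij.
    by have := cardsC (T4 z); rewrite card_ord; lia.
  apply: (half_approximates zopt).
    apply: best_of_feasible bs _ (single_item_feasible j adm).
    exact: add_item_feasible Tij wij.
  apply: le_trans (best_of_ge bs).
  have iT : i \notin T4 z by rewrite -in_setC Tij !inE eqxx.
  rewrite optimal_profit Tij big_setU1 ?inE //= big_set1 single_item_profit.
  rewrite set_profit_add_item // addrA.
  by rewrite !lerD // px // Tij !inE eqxx ?orbT.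
Qed.

End Approximation.

(** * Executions and their cost *)

Section Execution.
Variables (R : realFieldType) (O : lp_solver R).
Implicit Types (s : state R) (c : cmd) (Q : state R -> Prop).

Lemma exec_deterministic c s s1 t1 : exec O c s s1 t1 ->
  forall s2 t2, exec O c s s2 t2 -> s2 = s1 /\ t2 = t1.
Proof.
elim=> {c s s1 t1} [s|c1 c2 s s1 s2 t1 t2 _ IH1 _ IH2|v e s|a i j e s
  |b c1 c2 s s' t bT _ IH|b c1 c2 s s' t bF _ IH|b c s bF
  |b c s s1 s2 t1 t2 bT _ IH1 _ IH2|m k a b c z s L] s0 t0 E;
  inversion E; subst => //;
  first [by match goal with
    F : is_true (~~ ?x), T : is_true ?x |- _ => rewrite T in F end
  | repeat match goal with
    IH : (forall s t, exec O ?c ?s s t -> _), E' : exec O ?c ?s _ _ |- _ =>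
      case: (IH _ _ E') => ? ?; clear E'; subst end => //].
Qed.

(** The effect of loop-free commands; loops and solver calls have a default
    value. *)
Fixpoint run c s : state R :=
  match c with
  | CSeq c1 c2 => run c2 (run c1 s)
  | CNSet v e => set_reg s v (neval s e)
  | CRSet a i j e => set_cell s a (neval s i) (neval s j) (reval s e)
  | CIf b c1 c2 => if beval s b then run c1 s else run c2 s
  | _ => s
  end.

End Execution.

Fixpoint straight (c : cmd) : bool :=
  match c with
  | CSeq c1 c2 | CIf _ c1 c2 => straight c1 && straight c2
  | CWhile _ _ | CSolve _ _ _ _ _ _ => false
  | _ => true
  end.

Fixpoint cost (c : cmd) : nat :=
  match c with
  | CSkip => 1
  | CSeq c1 c2 => cost c1 + cost c2
  | CNSet _ e => (ncost e).+1
  | CRSet _ i j e => (ncost i + ncost j + rcost e).+1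
  | CIf b c1 c2 => (bcost b + maxn (cost c1) (cost c2)).+1
  | _ => 0
  end.

(** Register 0 holds the number of items, and register 1 is the loop counter. *)
Definition next_item := CNSet 1 (NAdd (NReg 1) (NLit 1)).

Definition for_loop (body : cmd) :=
  CSeq (CNSet 1 (NLit 0))
       (CWhile (BNLe (NAdd (NReg 1) (NLit 1)) (NReg 0)) (CSeq body next_item)).

Section TotalCorrectness.
Variables (R : realFieldType) (O : lp_solver R).
Implicit Types (s : state R) (c : cmd) (Q : state R -> Prop).

Definition halts c s T Q :=
  exists s' t, [/\ exec O c s s' t, (t <= T)%N & Q s'].

Lemma exec_straight c s : straight c ->
  exists2 t, exec O c s (run c s) t & (t <= cost c)%N.
Proof.
elim: c s => //= [|c1 IH1 c2 IH2|v e|a i j e|b c1 IH1 c2 IH2] s.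
- by exists 1%N => //; constructor.
- move=> /andP[/(IH1 s)[t1 E1 le1] /(IH2 (run c1 s))[t2 E2 le2]].
  by exists (t1 + t2)%N; [econstructor; eassumption|rewrite leq_add].
- by move=> _; eexists; [constructor|].
- by move=> _; eexists; [constructor|].
- move=> /andP[/(IH1 s)[t1 E1 le1] /(IH2 s)[t2 E2 le2]].
  case: ifP => [bT|/negbT bF].
    exists (bcost b + t1).+1; first by apply: ExIfT.
    by rewrite ltnS leq_add2l leq_max le1.
  exists (bcost b + t2).+1; first by apply: ExIfF.
  by rewrite ltnS leq_add2l leq_max le2 orbT.
Qed.

Lemma halts_straight c s Q : straight c -> Q (run c s) -> halts c s (cost c) Q.
Proof. by move=> /(exec_straight s)[t E le] Qs; exists (run c s), t. Qed.

Lemma halts_seq c1 c2 s T1 T2 Q1 Q2 : halts c1 s T1 Q1 ->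
  (forall s', Q1 s' -> halts c2 s' T2 Q2) -> halts (CSeq c1 c2) s (T1 + T2) Q2.
Proof.
move=> [s1 [t1 [E1 le1 Q1s]]] /(_ _ Q1s)[s2 [t2 [E2 le2 Q2s]]].
by exists s2, (t1 + t2)%N; split; [econstructor; eassumption|rewrite leq_add|].
Qed.

(** Besides the body, a round costs 5 for the test, 4 for the increment and 1
    for entering it; initialization and exit cost 8, which the extra
    round covers. *)
Lemma halts_for body s n (Inv : nat -> state R -> Prop) : straight body ->
  (forall i s', Inv i s' -> regs s' 0%N = n /\ regs s' 1%N = i) ->
  Inv 0%N (set_reg s 1 0) ->
  (forall i s', (i < n)%N -> Inv i s' ->
    Inv i.+1 (run next_item (run body s'))) ->
  halts (for_loop body) s ((cost body + 10) * n.+1) (Inv n).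
Proof.
move=> sb Ireg I0 IS.
have loop m i s' : (i + m)%N = n -> Inv i s' ->
    halts (CWhile (BNLe (NAdd (NReg 1) (NLit 1)) (NReg 0))
        (CSeq body next_item)) s'
      ((cost body + 10) * m + 6) (Inv n).
  elim: m i s' => [|m IH] i s' im Ii; have [r0 r1] := Ireg _ _ Ii.
    exists s', 6%N; split; [|by lia|by rewrite -im addn0].
    by apply: ExWhileF; rewrite /= r0 r1; lia.
  have lt_in : (i < n)%N by lia.
  have [|t Et let_] := @exec_straight (CSeq body next_item) s'.
    by rewrite /= sb.
  have [|s2 [t2 [E2 le2 Q2]]] := IH i.+1 _ _ (IS i s' lt_in Ii); first by lia.
  exists s2, (5 + t + t2).+1; split=> //.
    by apply: ExWhileT Et E2; rewrite /= r0 r1; lia.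
  by move: let_ le2 => /=; lia.
have [s' [t [E le Q]]] := loop n 0%N _ (add0n n) I0.
exists s', (2 + t)%N; split=> //; last by lia.
exact: (ExSeq (ExNSet O 1 (NLit 0) s) E).
Qed.

End TotalCorrectness.

(** * The program *)

Notation "c1 ;; c2" := (CSeq c1 c2) (at level 61, right associativity).

Definition rcol (a : nat) (e : nexp) := RCell a e (NLit 0).
Definition add2 (e : nexp) := NAdd (NLit 1) (NAdd (NLit 1) e).
Definition item := NReg 1.
Definition size_n := NReg 0.

(** Arrays 6, 7 and 8 receive the matrix, the right-hand side and the objective
    of the LP.  One item accounts for two columns of the matrix and for one row
    in each of its last three blocks. *)
Definition write_item :=
  CRSet 6 (NLit 0) item (rcol 1 item) ;;
  CRSet 6 (NLit 0) (NAdd size_n item) (RSub (rcol 2 item) (rcol 1 item)) ;;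
  CRSet 6 (NLit 1) (NAdd size_n item) ROne ;;
  CRSet 6 (add2 item) item (RSub RZero ROne) ;;
  CRSet 6 (add2 item) (NAdd size_n item) ROne ;;
  CRSet 6 (add2 (NAdd size_n item)) item ROne ;;
  CRSet 6 (add2 (NAdd size_n (NAdd size_n item))) (NAdd size_n item)
    (RSub RZero ROne) ;;
  CRSet 7 (add2 (NAdd size_n item)) (NLit 0) ROne ;;
  CRSet 8 (NLit 0) item (rcol 0 item).

Definition write_budgets :=
  CRSet 7 (NLit 0) (NLit 0) (rcol 3 (NLit 0)) ;;
  CRSet 7 (NLit 1) (NLit 0) (rcol 3 (NLit 1)).

Definition call_solver :=
  CSolve (add2 (NAdd size_n (NAdd size_n size_n))) (NAdd size_n size_n) 6 7 8 9.

Definition eq_real (e1 e2 : rexp) := BAnd (BRLe e1 e2) (BRLe e2 e1).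
Definition lp_x := rcol 9 item.
Definition lp_y := rcol 9 (NAdd size_n item).
Definition is_original := BAnd (eq_real lp_x ROne) (eq_real lp_y RZero).
Definition is_improved := BAnd (eq_real lp_x ROne) (eq_real lp_y ROne).
Definition is_unpacked := BAnd (eq_real lp_x RZero) (eq_real lp_y RZero).
Definition packed_profit := rcol 10 (NLit 0).

(** Register 4 counts the nonintegral items, registers 2 and 3 hold the last one
    and the one before it, and cell (0, 0) of array 10 accumulates the profit
    of the integral part. *)
Definition scan_item :=
  CIf (BAnd (BNot is_original) (BNot is_improved))
    (CIf is_unpacked CSkip
      (CNSet 3 (NReg 2) ;; CNSet 2 item ;; CNSet 4 (NAdd (NReg 4) (NLit 1))))
    (CRSet 10 (NLit 0) (NLit 0) (RAdd packed_profit (rcol 0 item))).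

(** Register 5 is set when the integral part is given up, and register 6 holds
    the successor of the item added in improved form, 0 standing for none.
    Deferring the output to the last pass avoids erasing an output. *)
Definition take_only (v : nat) :=
  CNSet 5 (NLit 1) ;; CNSet 6 (NAdd (NReg v) (NLit 1)).

Definition choose_solution :=
  CIf (BNLe (NReg 4) (NLit 0)) CSkip
  (CIf (BNLe (NReg 4) (NLit 1))
    (CIf (BRLe (rcol 0 (NReg 2)) packed_profit) CSkip (take_only 2))
    (CIf (BRLe (rcol 2 (NReg 2)) (rcol 2 (NReg 3))) CSkip
       (CNSet 1 (NReg 2) ;; CNSet 2 (NReg 3) ;; CNSet 3 (NReg 1)) ;;
     CIf (BRLe (rcol 0 (NReg 3)) (RAdd packed_profit (rcol 0 (NReg 2))))
       (CNSet 6 (NAdd (NReg 2) (NLit 1))) (take_only 3))).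

Definition emit_item :=
  CIf (BNLe (NReg 5) (NLit 0))
    (CIf is_original (CRSet 4 item (NLit 0) ROne) CSkip ;;
     CIf is_improved (CRSet 5 item (NLit 0) ROne) CSkip)
    CSkip ;;
  CIf (BAnd (BNLe (NAdd item (NLit 1)) (NReg 6))
            (BNLe (NReg 6) (NAdd item (NLit 1))))
    (CRSet 5 item (NLit 0) ROne) CSkip.

Definition algorithmB_program :=
  write_budgets ;; for_loop write_item ;; call_solver ;;
  for_loop scan_item ;; choose_solution ;; for_loop emit_item.

(** * Writing the LP *)

Section BuildLP.
Variables (R : realFieldType) (n : nat) (I : instance R n).
Implicit Types (s : state R).

(** The matrix of the relaxation by columns, because each round of the loop
    completes the two columns of one item. *)
Definition column_cell (r c : nat) : R :=
  if (c < n)%N then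
    if r == 0%N then load_vec (weight I) c
    else if r == c.+2 then -1 else if r == (n + c).+2 then 1 else 0
  else let i := (c - n)%N in
    if r == 0%N then load_vec (iweight I) i - load_vec (weight I) i
    else if (r == 1%N) || (r == i.+2) then 1
    else if r == (n + (n + i)).+2 then -1 else 0.

Definition rhs_cell (i r : nat) : R :=
  if r == 0%N then capacity I else if r == 1%N then (ibudget I)%:R
  else ((n.+2 <= r < n.+2 + i)%N)%:R.

Lemma load_vecE (f : 'I_n -> R) (i : 'I_n) : load_vec f i = f i.
Proof. by rewrite /load_vec valK. Qed.

(** The sizes are variables here, as the dimensions of the matrices would not
    allow to rewrite the values of the expressions that compute them. *)
Lemma read_relaxation s m k :
  m = (1 + (1 + (n + (n + n))))%N -> k = (n + n)%N ->
  (forall r c, (c < n + n)%N -> cells s 6%N r c = column_cell r c) ->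
  (forall r, cells s 7%N r 0%N = rhs_cell n r) ->
  (forall c, (c < n)%N -> cells s 8%N 0%N c = load_vec (profit I) c) ->
  (forall c, (n <= c)%N -> cells s 8%N 0%N c = 0) ->
  read_lp s m k 6 7 8 = relaxation I.
Proof.
move=> -> -> cA cb cp c0; rewrite /read_lp /relaxation; congr LP.
- apply/matrixP => r c; rewrite mxE cA // /column_cell.
  case: (split_ordP c) => i ->; rewrite ?ltn_ord /=;
    rewrite ?ltnNge ?leq_addr /= ?addKn; move: r;
    do 4?(apply: forall_split => [r|]); try move=> r;
    rewrite /= ?(col_mxEu, col_mxEd, row_mxEl, row_mxEr) !mxE ?ord1 ?load_vecE
      -?val_eqE //=;
    have := ltn_ord i; try have := ltn_ord r;
    repeat (case: eqP => /=; intros); try lia; rewrite ?opprB ?oppr0 //.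
- apply/colP => r; rewrite mxE cb /rhs_cell; move: r;
    do 4?(apply: forall_split => [r|]); try move=> r;
    rewrite /= ?(col_mxEu, col_mxEd) !mxE ?ord1 //=;
    have := ltn_ord r => ?; repeat (case: ltnP => /=; intros); try lia; by [].
- apply/rowP; apply: forall_split => i.
    by rewrite mxE cp //= row_mxEl mxE load_vecE.
  by rewrite mxE c0 ?leq_addr //= row_mxEr mxE.
Qed.

Definition reads_input s :=
  forall a r c, a \notin [:: 6; 7; 8]%N -> cells s a r c = cells (load I) a r c.

Definition lp_written i s :=
  [/\ regs s 0%N = n, regs s 1%N = i, forall v, (1 < v)%N -> regs s v = 0%N,
      reads_input s
    & [/\ forall r c, cells s 6%N r c =
            if (c < i)%N || (n <= c < n + i)%N then column_cell r c else 0,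
          forall r, cells s 7%N r 0%N = rhs_cell i r
        & forall c, cells s 8%N 0%N c =
            if (c < i)%N then load_vec (profit I) c else 0]].

Lemma lp_written0 : lp_written 0 (set_reg (run write_budgets (load I)) 1 0).
Proof.
split=> //.
- by case=> [|[]].
- move=> a r c; rewrite !inE /=; by do 9?(case: a => [|a] //=).
- split=> [r c|[|[|r]]|c] //=; first by rewrite ifF //; lia.
  by rewrite /rhs_cell /=; case: (boolP (_ && _)) => //; lia.
Qed.

Lemma lp_writtenS i s : (i < n)%N -> lp_written i s ->
  lp_written i.+1 (run next_item (run write_item s)).
Proof.
move=> lt_in [r0 r1 rv cl [c6 c7 c8]].
have cl0 a r c : (a < 4)%N -> cells s a r c = cells (load I) a r c.
  by move=> ?; apply: cl; rewrite !inE; lia.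
split=> //=.
- by rewrite r1 addn1.
- by move=> [|[|v]] //= _; apply: rv.
- move=> a r c na; rewrite -cl //; move: na; rewrite !inE !negb_or.
  by move=> /and3P[/negPf a6 /negPf a7 /negPf a8]; rewrite /= a6 a7 a8.
- rewrite r0 r1 !cl0 //= sub0r; split=> [r c|r|c].
  + rewrite c6 /column_cell.
    have [->|ci] := eqVneq c i; last have [->|cni] := eqVneq c (n + i)%N.
    * rewrite (_ : (i == n + i)%N = false) ?andbF ?andbT; last by lia.
      rewrite ltnn ltnSn lt_in leqNgt lt_in /=.
      by repeat (case: eqP => //=; intros); lia.
    * rewrite (_ : (n + i < i.+1)%N = false) ?andbF ?andbT; last by lia.
      rewrite ltnn andbF orbF (_ : (n + i < i)%N = false); last by lia.
      rewrite leq_addr ltn_add2l ltnSn /= addKn ltnNge leq_addr /=.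
      by repeat (case: eqP => //=; intros); lia.
    * rewrite !andbF (_ : (c < i.+1)%N = (c < i)%N); last by lia.
      by rewrite (_ : (c < n + i.+1)%N = (c < n + i)%N); last by lia.
  + rewrite c7 /rhs_cell andbT !add1n; case: r => [|[|r]] //=.
    have [-> | ne] := eqVneq r.+2 (n + i).+2.
      by rewrite (_ : (_ <= _ < _)%N) //; lia.
    by congr (_%:R); congr nat_of_bool; lia.
  + rewrite c8 /= ltnS; case: eqVneq => [->|ne]; first by rewrite leqnn.
    by rewrite ltn_neqAle ne.
Qed.
End BuildLP.

Lemma run_seq (R : realFieldType) c1 c2 (s : state R) :
  run (c1 ;; c2) s = run c2 (run c1 s).
Proof. by []. Qed.

Lemma run_if (R : realFieldType) b c1 c2 (s : state R) :
  run (CIf b c1 c2) s = if beval s b then run c1 s else run c2 s.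
Proof. by []. Qed.

(** * Rounding the LP solution *)

Section RoundingLP.
Variables (R : realFieldType) (n : nat) (I : instance R n).
Variable z : 'cV[R]_(n + n).
Implicit Types (s : state R).

Definition original_at k :=
  (load_vec (xval z) k == 1) && (load_vec (yval z) k == 0).
Definition improved_at k :=
  (load_vec (xval z) k == 1) && (load_vec (yval z) k == 1).
Definition unpacked_at k :=
  (load_vec (xval z) k == 0) && (load_vec (yval z) k == 0).
Definition integral_at k :=
  [|| original_at k, improved_at k | unpacked_at k].

Lemma mem_J4w (i : 'I_n) : (i \in J4w z) = original_at i.
Proof.
rewrite in_set mem_T4 /original_at !load_vecE.
by apply: andb_idl => ->.
Qed.

Lemma mem_J4i (i : 'I_n) : (i \in J4i z) = improved_at i.
Proof.
rewrite in_set mem_T4 /improved_at !load_vecE.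
by apply: andb_idl => ->; rewrite orbT.
Qed.

Lemma mem_nonintegral (i : 'I_n) : (i \in ~: T4 z) = ~~ integral_at i.
Proof.
by rewrite in_setC mem_T4 /integral_at /original_at /improved_at /unpacked_at
  !load_vecE.
Qed.

Definition holds_solution s :=
  [/\ regs s 0%N = n,
      forall a r c, a \notin [:: 4; 5; 6; 7; 8; 9; 10]%N ->
        cells s a r c = cells (load I) a r c,
      forall k, (k < n)%N -> cells s 9%N k 0%N = load_vec (xval z) k
    & forall k, (k < n)%N -> cells s 9%N (n + k)%N 0%N = load_vec (yval z) k].

Definition no_output s := forall a r c,
  (a == 4%N) || (a == 5%N) -> cells s a r c = 0.

(** Most recent item first: the order in which the registers keep them. *)
Definition nonintegral_before i := rev [seq k <- iota 0 i | ~~ integral_at k].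

Definition scanned i s :=
  [/\ holds_solution s, no_output s, regs s 1%N = i,
      [/\ regs s 5%N = 0%N, regs s 6%N = 0%N,
          regs s 4%N = size (nonintegral_before i),
          regs s 2%N = nth 0%N (nonintegral_before i) 0
        & regs s 3%N = nth 0%N (nonintegral_before i) 1]
    & cells s 10%N 0%N 0%N =
        \sum_(0 <= k < i | original_at k || improved_at k)
           load_vec (profit I) k].

Lemma tests_item s i : (i < n)%N -> holds_solution s -> regs s 1%N = i ->
  [/\ beval s is_original = original_at i, beval s is_improved = improved_at i
    & beval s is_unpacked = unpacked_at i].
Proof.
move=> lt_in [r0 _ xs ys] r1.
by rewrite /= !r0 !r1 xs // ys // -!eq_le; split; rewrite -?[in LHS]eq_le //.
Qed.

Lemma scannedS i s : (i < n)%N -> scanned i s ->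
  scanned i.+1 (run next_item (run scan_item s)).
Proof.
move=> lt_in [hs no r1 [r5 r6 r4 r2 r3] acc].
have [ti tm tu] := tests_item lt_in hs r1.
have nbS : nonintegral_before i.+1 = if integral_at i then nonintegral_before i
    else i :: nonintegral_before i.
  rewrite /nonintegral_before -addn1 iotaD filter_cat rev_cat /=.
  by case: integral_at.
have accS : \sum_(0 <= k < i.+1 | original_at k || improved_at k)
    load_vec (profit I) k = cells s 10%N 0%N 0%N +
    (if original_at i || improved_at i then load_vec (profit I) i else 0).
  by rewrite acc big_mkcond big_nat_recr //= -big_mkcond.
have [r0 cl xs ys] := hs.
have c0 : cells s 0%N i 0%N = load_vec (profit I) i by apply: cl.
have -> : run scan_item s =
    if ~~ original_at i && ~~ improved_at i then
      if unpacked_at i then s else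
      set_reg (set_reg (set_reg s 3 (regs s 2%N)) 2 (regs s 1%N)) 4
        (regs s 4%N + 1)
    else set_cell s 10 0 0 (cells s 10%N 0%N 0%N + cells s 0%N (regs s 1%N) 0%N).
  by rewrite -ti -tm -tu.
move: nbS accS; rewrite /integral_at -negb_or orbA.
case: (original_at i || improved_at i) => /= nbS accS; last first.
  rewrite addr0 in accS; case: (unpacked_at i) nbS => nbS.
    by do 2?split; rewrite /= ?nbS ?accS ?r1 ?addn1.
  by do 2?split; rewrite /= ?nbS ?accS ?r1 ?r4 ?r2 ?addn1.
rewrite r1 c0; split; rewrite /= ?nbS ?accS ?r1 ?addn1 //.
  split=> // a r c na; rewrite -cl //; move: na; rewrite !inE !negb_or.
  by do 6![case/andP=> _]; move=> /negPf a10; rewrite /= a10.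
by move=> a r c a45; rewrite -(no a r c a45) /=; case/orP: a45 => /eqP->.
Qed.

Lemma scan_invariant i s : scanned i s -> regs s 0%N = n /\ regs s 1%N = i.
Proof. by case=> -[]. Qed.

(** [keep] and [extra] are the decisions stored in registers 5 and 6. *)
Definition emitted keep extra i s :=
  [/\ holds_solution s, regs s 1%N = i,
      regs s 5%N = ~~ keep, regs s 6%N = extra
    & forall k,
       (cells s 4%N k 0%N = ((k < i)%N && (keep && original_at k))%:R) /\
       (cells s 5%N k 0%N =
         ((k < i)%N && (keep && improved_at k || (k.+1 == extra)))%:R)].

Lemma holds_solution_output s a i v : (a == 4%N) || (a == 5%N) ->
  holds_solution s -> holds_solution (set_cell s a i 0 v).
Proof.
move=> a45 [r0 cl xs ys]; split=> // [a' r c na|k lt_kn|k lt_kn].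
- rewrite -cl //=; case: eqP na => // ->.
  by rewrite !inE orbA a45.
- by rewrite -xs //; rewrite /=; case/orP: a45 => /eqP->.
- by rewrite -ys //=; case/orP: a45 => /eqP->.
Qed.

(** The three conditional writes are replayed as the states [s1], [s2], [s3];
    the first one does not disturb the test of the second, which reads the LP
    solution only. *)
Lemma emittedS keep extra i s : (i < n)%N -> emitted keep extra i s ->
  emitted keep extra i.+1 (run next_item (run emit_item s)).
Proof.
move=> lt_in [hs r1 r5 r6 out].
pose s1 := if keep && original_at i then set_cell s 4 i 0 1 else s.
pose s2 := if keep && improved_at i then set_cell s1 5 i 0 1 else s1.
pose s3 := if i.+1 == extra then set_cell s2 5 i 0 1 else s2.
have hs1 : holds_solution s1.
  by rewrite /s1; case: ifP => // _; apply: holds_solution_output.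
have hs3 : holds_solution s3.
  rewrite /s3 /s2; case: ifP => _; case: ifP => _ //;
    by do ?apply: holds_solution_output.
have rg1 : regs s1 = regs s by rewrite /s1; case: ifP.
have rg2 : regs s2 = regs s by rewrite /s2; case: ifP.
have rg3 : regs s3 = regs s by rewrite /s3; case: ifP.
have -> : run emit_item s = s3.
  have [to _ _] := tests_item lt_in hs r1.
  have [|_ tm _] := tests_item lt_in hs1; first by rewrite rg1.
  have E1 : keep ->
      run (CIf is_original (CRSet 4 item (NLit 0) ROne) CSkip) s = s1.
    by rewrite run_if to /s1 /= r1 => ->.
  have E2 : keep ->
      run (CIf is_improved (CRSet 5 item (NLit 0) ROne) CSkip) s1 = s2.
    by rewrite run_if tm /s2 /= rg1 r1 => ->.
  rewrite /emit_item run_seq [run (CIf (BNLe _ _) _ _) s]run_if.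
  have -> : beval s (BNLe (NReg 5) (NLit 0)) = keep.
    by rewrite /= r5; case: (keep).
  rewrite run_seq; have -> : (if keep then
      run (CIf is_improved (CRSet 5 item (NLit 0) ROne) CSkip)
        (run (CIf is_original (CRSet 4 item (NLit 0) ROne) CSkip) s)
      else run CSkip s) = s2.
    by case kE: keep; [rewrite E1 // E2 | rewrite /s2 /s1 kE].
  by rewrite run_if /= rg2 r1 r6 -eqn_leq addn1.
have ltS k : (k < i.+1)%N = (k == i) || (k < i)%N by rewrite ltnS leq_eqVlt.
split; rewrite /= ?rg3 ?r1 ?addn1 //.
move=> k; have [o4 o5] := out k; rewrite ltS; split.
  have -> : cells s3 4%N k 0%N = cells s1 4%N k 0%N.
    by rewrite /s3 /s2; case: ifP => _; case: ifP.
  rewrite /s1; have [ki|ki] := eqVneq k i.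
    rewrite ki; case: ifP => _; first by rewrite /= eqxx.
    by rewrite -ki o4 ki ltnn.
  by case: ifP => _ //; rewrite /= (negPf ki).
rewrite /s3 /s2; have [ki|ki] := eqVneq k i.
  rewrite ki in o5 *.
  case: eqP => _ /=; first by rewrite eqxx orbT.
  case: ifP => [_|_] /=; first by rewrite eqxx.
  by rewrite /s1; case: ifP => _ /=; rewrite o5 ltnn.
have s1E : cells s1 5%N k 0%N = cells s 5%N k 0%N by rewrite /s1; case: ifP.
by case: ifP => _; rewrite /= ?(negPf ki); case: ifP => _;
  rewrite /= ?(negPf ki) s1E.
Qed.

Definition chosen s := exists keep extra,
  emitted keep extra 0 (set_reg s 1 0) /\
  algorithmB I z (if keep then J4w z else set0,
    [set i | keep && (i \in J4i z) || (i.+1 == extra)]).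

Lemma packed_profitE : 
  \sum_(0 <= k < n | original_at k || improved_at k) load_vec (profit I) k =
  set_profit I (J4w z) (J4i z).
Proof.
rewrite big_mkord [LHS]big_mkcond; apply: eq_bigr => i _.
rewrite in_setU mem_J4w mem_J4i load_vecE.
by case: (_ || _); rewrite ?mulr1 ?mulr0.
Qed.

Lemma nonintegral_before_all :
  nonintegral_before n = map val (rev (enum (~: T4 z))).
Proof.
rewrite /nonintegral_before -val_enum_ord filter_map map_rev.
congr (rev (map _ _)).
by rewrite enumT; apply: eq_filter => i; rewrite /= -mem_nonintegral.
Qed.

(** The recorded items are exactly those outside T4, so their number selects the
    step of the algorithm; in Step 4 the registers are first swapped, if
    necessary, into the order of the improved weights. *)
Lemma choose_correct s : lp_optimal_basic (relaxation I) z ->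
  scanned n s -> chosen (run choose_solution s).
Proof.
move=> zopt [hs no r1 [r5 r6]].
rewrite nonintegral_before_all packed_profitE; set r := rev _ => r4 r2 r3 acc.
have uniqr : uniq r by rewrite rev_uniq enum_uniq.
have le2 : (size r <= 2)%N by rewrite size_rev -cardE (card_nonintegral zopt).
have TE : ~: T4 z = [set i in r].
  by apply/setP => i; rewrite [RHS]inE mem_rev mem_enum.
have [r0 cl _ _] := hs.
have c0 (i : 'I_n) : cells s 0%N i 0%N = profit I i.
  by rewrite cl //=; apply: load_vecE.
have c2 (i : 'I_n) : cells s 2%N i 0%N = iweight I i.
  by rewrite cl //=; apply: load_vecE.
have emit0 keep extra s' : cells s' = cells s -> regs s' 0%N = n ->
    regs s' 5%N = ~~ keep -> regs s' 6%N = extra ->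
    emitted keep extra 0 (set_reg s' 1 0).
  move=> cs r0' r5' r6'; split=> //.
    by case: hs => _ ? ? ?; split=> //; rewrite /= cs.
  by move=> k; rewrite /= cs !no.
have keepE (S : {set 'I_n}) e : [set i : 'I_n | (i \in S) || (i.+1 == e)] =
    S :|: [set i : 'I_n | i.+1 == e].
  by apply/setP => i; rewrite !inE.
have succE (i : 'I_n) : [set j : 'I_n | j.+1 == i.+1] = [set i].
  by apply/setP => j; rewrite !inE eqSS.
have none : [set j : 'I_n | j.+1 == 0%N] = set0 by apply/setP => j; rewrite !inE.
clearbody r; case: r r4 r2 r3 uniqr le2 TE => [|i [|j [|? ?]]] // r4 r2 r3.
- move=> _ _ TE; rewrite /choose_solution run_if /= r4.
  exists true, 0%N; split; first by apply: emit0; rewrite /= ?r0 ?r5 ?r6.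
  rewrite keepE none setU0; apply: algorithmB_step2.
  by rewrite TE; apply/setP => k; rewrite !inE.
- move=> _ _ TE.
  have {}TE : ~: T4 z = [set i] by rewrite TE; apply/setP => k; rewrite !inE.
  rewrite /choose_solution run_if /= r4 /= r2 c0 acc.
  case: leP => [le|/ltW le].
    exists true, 0%N; split; first by apply: emit0; rewrite /= ?r0 ?r5 ?r6.
    rewrite keepE none setU0; apply: (algorithmB_step3 TE); left.
    by rewrite /= single_item_profit.
  exists false, i.+1; split.
    by apply: emit0; rewrite /= ?r0 ?r5 ?r6 ?r2 ?addn1.
  rewrite /= succE; apply: (algorithmB_step3 TE); right.
  by rewrite /= single_item_profit.
- rewrite [uniq _]/= andbT inE => ij _ TE.
  have {}TE : ~: T4 z = [set i; j] by rewrite TE; apply/setP => k; rewrite !inE.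
  rewrite /choose_solution run_if /= r4 /=.
  (* The state after the swap, where the registers 2 and 3 hold a and b. *)
  set s1 := if _ then s else _.
  have [a [b [ab Tab wab [ra rb]]]] : exists a b : 'I_n,
      [/\ a != b, ~: T4 z = [set a; b], iweight I a <= iweight I b
        & regs s1 2%N = a /\ regs s1 3%N = b].
    rewrite /s1 r2 r3 !c2; case: leP => [le|/ltW le]; first by exists i, j.
    by exists j, i; rewrite eq_sym ij setUC.
  have cs1 : cells s1 = cells s by rewrite /s1; case: ifP.
  have rs1 v : v \notin [:: 1; 2; 3]%N -> regs s1 v = regs s v.
    rewrite !inE !negb_or => /and3P[/negPf n1 /negPf n2 /negPf n3].
    by rewrite /s1; case: ifP; rewrite /= ?n1 ?n2 ?n3.
  have aT : a \notin T4 z by rewrite -in_setC Tab !inE eqxx.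
  have pa : set_profit I (J4w z) (a |: J4i z) =
      set_profit I (J4w z) (J4i z) + profit I a.
    exact: set_profit_add_item.
  rewrite cs1 ra rb !c0 acc; case: leP => [le|/ltW le].
    exists true, a.+1; split.
      by apply: emit0; rewrite //= ?rs1 ?r0 ?r5 ?ra ?addn1.
    rewrite keepE succE setUC; apply: (algorithmB_step4 zopt ab Tab wab); left.
    by rewrite /= single_item_profit pa.
  exists false, b.+1; split.
    by apply: emit0; rewrite //= ?rs1 ?r0 ?r5 ?rb ?addn1.
  rewrite /= succE; apply: (algorithmB_step4 zopt ab Tab wab); right.
  by rewrite /= single_item_profit pa.
Qed.

End RoundingLP.

(** * Correctness and running time *)

Section Correctness.
Variables (R : realFieldType) (O : lp_solver R).

(** The relaxation satisfies the conditions under which the solver is bound to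
    its specification: 0 is feasible, all x lie in [0, 1], and the last two
    blocks of rows give full column rank. *)
Lemma relaxation_optimal n (I : instance R n) : admissible I ->
  lp_optimal_basic (relaxation I) (lp_solve O (relaxation I)).
Proof.
move=> [B0 k0 adm]; apply: lp_solveP.
- exists (point (fun=> 0) (fun=> 0)); apply/relaxation_feasible; split=> [||i].
  + rewrite /used_capacity big1 // => i _.
    by rewrite xval_point yval_point !mulr0 subr0.
  + by rewrite big1 // => i _; rewrite yval_point.
  + by rewrite xval_point yval_point ler01.
- exists (\sum_i `|profit I i|) => z /relaxation_feasible[_ _ fi].
  rewrite relaxation_value; apply: ler_sum => i _; have [yx x1 y0] := fi i.
  apply: le_trans (ler_norm _) _; rewrite normrM ler_piMr //.
  by rewrite ger0_norm // (le_trans y0 yx).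
- apply/full_rank_kernel => v; rewrite relaxation_mul => v0.
  rewrite -(point_val v) /point; apply/colP; apply: forall_split => i.
    have /matrixP/(_ (rshift 1 (rshift 1 (rshift n (lshift _ i)))) 0) := v0.
    by rewrite !(col_mxEd, col_mxEu) !mxE.
  have /matrixP/(_ (rshift 1 (rshift 1 (rshift n (rshift n i)))) 0) := v0.
  rewrite !(col_mxEd, col_mxEu) !mxE => /eqP.
  by rewrite oppr_eq0 => /eqP.
Qed.

(** The arrays hold the relaxation itself, so the solver takes the time of the
    relaxation; the constant pays for evaluating the dimensions. *)
Lemma call_solver_correct n (I : instance R n) s : lp_written I n s ->
  halts O call_solver s (lp_time O (relaxation I) + 20)
    (fun s' => scanned I (lp_solve O (relaxation I)) 0 (set_reg s' 1 0)).
Proof.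
move=> [r0 r1 rv cl [c6 c7 c8]].
have LE : read_lp s (neval s (add2 (NAdd size_n (NAdd size_n size_n))))
    (neval s (NAdd size_n size_n)) 6 7 8 = relaxation I.
  apply: read_relaxation => [||r c lt_c||c lt_c|c le_c]; rewrite /= ?r0 //.
  - by rewrite c6 ifT //; lia.
  - by rewrite c8 lt_c.
  - by rewrite c8 ltnNge le_c.
have := ExSolve O (add2 (NAdd size_n (NAdd size_n size_n)))
  (NAdd size_n size_n) 6 7 8 9 s.
rewrite LE => E; eexists; eexists; split; [exact: E | by rewrite /=; lia |].
have wE (i : 'I_(n + n)) : cells (write_col s 9 (lp_solve O (relaxation I)))
    9%N i 0%N = lp_solve O (relaxation I) i 0.
  by rewrite /= valK.
split=> //=.
- split=> // [a r c na|k lt_kn|k lt_kn].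
  + move: na; rewrite !inE !negb_or => /and4P[_ _ n6 /and4P[n7 n8 /negPf n9 _]].
    by rewrite -cl ?inE ?negb_or ?n6 ?n7 //= n9.
  + by rewrite (wE (lshift n (Ordinal lt_kn))) (load_vecE _ (Ordinal lt_kn)).
  + by rewrite (wE (rshift n (Ordinal lt_kn))) (load_vecE _ (Ordinal lt_kn)).
- by move=> a r c /orP[]/eqP-> /=; rewrite cl.
- by split; rewrite /= ?rv.
- by rewrite big_nil cl.
Qed.

Lemma emitted_output n (I : instance R n) z keep extra s :
  emitted I z keep extra n s -> output n s =
    (if keep then J4w z else set0,
     [set i | keep && (i \in J4i z) || (i.+1 == extra)]).
Proof.
case=> _ _ _ _ out; rewrite /output; congr (_, _).
  apply/setP => i; have [o4 _] := out i.
  rewrite [LHS]in_set o4 ltn_ord /= pnatr_eq1 eqb1.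
  by case: (keep); rewrite ?mem_J4w ?in_set0.
apply/setP => i; have [_ o5] := out i.
by rewrite [LHS]in_set [RHS]in_set o5 ltn_ord /= pnatr_eq1 eqb1 mem_J4i.
Qed.

Definition overhead :=
  (cost write_budgets + (cost write_item + 10) + 20 + (cost scan_item + 10)
   + cost choose_solution + (cost emit_item + 10))%N.

Lemma program_correct n (I : instance R n) : admissible I ->
  halts O algorithmB_program (load I)
    (lp_time O (relaxation I) + overhead * n.+1)
    (fun s => algorithmB I (lp_solve O (relaxation I)) (output n s)).
Proof.
move=> adm; have zopt := relaxation_optimal adm.
set z := lp_solve _ _ in zopt *.
have H : halts O algorithmB_program (load I)
  (cost write_budgets + ((cost write_item + 10) * n.+1 +
   ((lp_time O (relaxation I) + 20) + ((cost scan_item + 10) * n.+1 +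
   (cost choose_solution + (cost emit_item + 10) * n.+1)))))
   (fun s => algorithmB I z (output n s)).
  apply: (halts_seq (Q1 := fun s => s = run write_budgets (load I))).
    exact: halts_straight.
  move=> _ ->; apply: (halts_seq (Q1 := lp_written I n)).
    apply: halts_for => //; first by move=> i s [].
      exact: lp_written0.
    exact: lp_writtenS.
  move=> s1 /call_solver_correct H1; apply: (halts_seq H1) => s2 Q2.
  apply: (halts_seq (Q1 := scanned I z n)).
    apply: halts_for Q2 _ => //; first exact: scan_invariant.
    exact: scannedS.
  move=> s3 Q3; apply: (halts_seq (Q1 := chosen I z)).
    by apply: halts_straight => //; apply: choose_correct.
  move=> s4 [keep [extra [Q4 AB]]].
  have [] : halts O (for_loop emit_item) s4 ((cost emit_item + 10) * n.+1)
      (emitted I z keep extra n).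
    apply: halts_for Q4 _ => //; first by move=> i s [[]].
    exact: emittedS.
  move=> s5 [t [E le Q5]]; exists s5, t; split=> //.
  by rewrite (emitted_output Q5).
have [s [t [E le Q]]] := H; exists s, t; split=> //; apply: leq_trans le _.
by rewrite /overhead; lia.
Qed.

End Correctness.

Theorem theorem5p3 (R : realFieldType) :
  (forall (n : nat) (I : instance R n) (z : 'cV[R]_(n + n)),
     admissible I -> lp_optimal_basic (relaxation I) z ->
     (exists s, algorithmB I z s) /\
     (forall S T, algorithmB I z (S, T) -> approximates I 2 S T)) /\
  (exists P : cmd,
     [/\ implements_algorithmB R P, runs_in_lp_time R P
       & runs_in_poly_time R P]).
Proof.
split=> [n I z adm zopt|].
  split; first exact: algorithmB_total.
  by move=> S T; apply: algorithmB_approximates.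
have time (O : lp_solver R) n (I : instance R n) s t : admissible I ->
    exec O algorithmB_program (load I) s t ->
    (t <= lp_time O (relaxation I) + overhead * n.+1)%N.
  move=> adm E; have [s' [t' [E' le _]]] := program_correct O adm.
  by have [_ <-] := exec_deterministic E E'.
exists algorithmB_program; split.
- move=> O n I adm; have [s [t [E _ AB]]] := program_correct O adm.
  by exists s, t.
- by exists overhead => O n I s t; apply: time.
move=> O lsize isize [C1 [d1 le1]] [C2 [d2 le2]] leI.
(* With m = isize + 1, the LP has size at most C2 m^d2, and
   C2 m^d2 + 1 <= (C2 + 1) m^d2. *)
exists (C1 * (C2 + 1) ^ d1 + overhead)%N, (d2 * d1 + 1)%N => n I s t adm E.
apply: leq_trans (time _ _ _ _ _ adm E) _.
rewrite mulnDl; set m := isize _.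
have m0 : (0 < m.+1)%N by [].
apply: leq_add; last first.
  rewrite leq_mul2l; apply/orP; right.
  rewrite addn1 expnS -[n.+1]muln1 leq_mul ?expn_gt0 //.
  by have := leI (existT _ n I); rewrite /= ltnS.
apply: leq_trans (le1 _) _; rewrite -mulnA leq_mul2l; apply/orP; right.
apply: (@leq_trans (((C2 + 1) * m.+1 ^ d2) ^ d1)).
  case: (posnP d1) => [-> | d1_gt0]; rewrite ?expn0 ?leq_exp2r //.
  rewrite mulnDl mul1n -addn1 leq_add ?expn_gt0 //.
  exact: (le2 (existT _ n I)).
by rewrite expnMn -expnM leq_mul2l leq_pexp2l ?orbT // addn1.
Qed.
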